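(* Let $K$ be an infinite field of arbitrary characteristic, let $m\ge 1$, $r\ge 1$, and let $V$ be the natural $m$-dimensional $GL(m)$-module over $K$. Then there is an isomorphism $$S(m,r)\simeq \mathrm{End}_{K\Sigma_r}(V^{\otimes r})^{op},$$ namely the one given by the map $\Psi_r$; that is, $\Psi_r$ is surjective onto $\mathrm{End}_{K\Sigma_r}(V^{\otimes r})^{op}$.
   Context: $V$ has basis $v_1,\dots,v_m$. For a multi-index $I=(i_1,\dots,i_r)$ with entries in $\{1,\dots,m\}$, $v_I=v_{i_1}\otimes\cdots\otimes v_{i_r}$. The symmetric group $\Sigma_r$ acts on $V^{\otimes r}$ on the right by place permutations: the transposition $\tau_j=(j,j+1)$ sends $v_I$ to $v_{I.(j,j+1)}$, where $I.(j,j+1)$ is $I$ with its $j$th and $(j+1)$st entries exchanged. The group $GL(m)$ acts on the left diagonally, $g.v_I=g.v_{i_1}\otimes\cdots\otimes g.v_{i_r}$; correspondingly the distribution algebra (hyperalgebra) $Dist(GL(m))$ of the algebraic group $GL(m)$ over $K$ acts on $V^{\otimes r}$, with the matrix units $e_{ij}\in Dist_1(GL(m))$ acting on $V$ by $e_{ij}v_k=\delta_{jk}v_i$ and on $V^{\otimes r}$ as derivations. The two actions commute, and $\Psi_r: Dist(GL(m))\to \mathrm{End}_{K\Sigma_r}(V^{\otimes r})^{op}$ denotes the induced map sending an element to the operator by which it acts. $\mathrm{End}_{K\Sigma_r}(V^{\otimes r})$ is the space of all $K$-linear endomorphisms of $V^{\otimes r}$ commuting with the action of $\Sigma_r$. The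 Schur algebra $S(m,r)$ is by definition the image of $Dist(GL(m))$ in $\mathrm{End}_K(V^{\otimes r})$. The superscript $op$ is a convention about the order of composition; surjectivity of $\Psi_r$ means that, as subspaces of $\mathrm{End}_K(V^{\otimes r})$, $S(m,r)$ equals $\mathrm{End}_{K\Sigma_r}(V^{\otimes r})$. *)

(* Defs.v *)
From HB Require Import structures.
From mathcomp Require Import all_boot all_order all_fingroup all_algebra.
From mathcomp Require Import mpoly.
From mathcomp Require Import classical_sets cardinality.

Set Implicit Arguments.
Unset Strict Implicit.
Unset Printing Implicit Defensive.

Import GRing.Theory.
Local Open Scope ring_scope.

(** K[GL(m)] = K[x_ij, d] / (d * det(x_ij) - 1), presented by m * m + 1
    polynomial variables: the x_ij, followed by d. *)
Notation glpoly K m := {mpoly K[m * m + 1]}.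

Section CoordinateRing.
Variables (K : fieldType) (m : nat).

Definition xgen (i j : 'I_m) : glpoly K m := 'X_(lshift 1 (mxvec_index i j)).
Definition dgen : glpoly K m := 'X_(rshift (m * m) ord0).

Definition xmx : 'M[glpoly K m]_m := \matrix_(i, j) xgen i j.
Definition glrel : glpoly K m := dgen * \det xmx - 1.

Definition glpoint (g : 'M[K]_m) (k : 'I_(m * m + 1)) : K :=
  row_mx (mxvec g) (const_mx (\det g)^-1 : 'rV_1) ord0 k.

(** Its zero set is the augmentation ideal I, whose power I^{n+1} is spanned by
    the products of n + 1 elements of I. *)
Definition counit (f : glpoly K m) : K := f.@[glpoint 1%:M].

(** Dist(GL(m)) is the union over n of the spaces of linear forms on K[GL(m)]
    vanishing on I^{n+1}; a linear form on K[GL(m)] is a linear form on the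
    polynomial ring vanishing on the ideal of relations. *)
Record distribution := Distribution {
  dist_form :> {scalar glpoly K m};
  dist_rel : forall f, dist_form (f * glrel) = 0;
  dist_order : exists n : nat, forall fs : seq (glpoly K m),
    size fs = n.+1 -> {in fs, forall f, counit f = 0} ->
    dist_form (\prod_(f <- fs) f) = 0
}.

End CoordinateRing.

Section TensorSpace.
Variables (K : fieldType) (m r : nat).

Local Notation multiindex := {ffun 'I_r -> 'I_m}.

(** The r-th tensor power of V = K^m, in coordinates with respect to the basis
    of the v_I. *)
Local Notation tensor := {ffun multiindex -> K^o}.

Definition tbasis (I : multiindex) : tensor := [ffun J => (J == I)%:R].

Definition pure_tensor (w : 'I_r -> 'cV[K]_m) : tensor :=
  [ffun I : multiindex => \prod_(k < r) w k (I k) ord0].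

(** Products of permutations compose from left to right in MathComp, so the
    inverse is what makes this a right action. *)
Definition mi_act (I : multiindex) (s : 'S_r) : multiindex :=
  [ffun k => I ((s^-1)%g k)].

Definition place (s : 'S_r) (t : tensor) : tensor :=
  \sum_(I : multiindex) t I *: tbasis (mi_act I s).

(** The comodule structure of the tensor power: v_j |-> \sum_i v_i (x) x_ij on
    V, extended multiplicatively. An element of (tensor power) (x) K[GL(m)] is
    given by its coefficients on the v_I. *)
Definition coact (t : tensor) (I : multiindex) : glpoly K m :=
  \sum_(J : multiindex) t J *: \prod_(k < r) xgen K (I k) (J k).

(** (id (x) mu) after the comodule map, for any linear form mu. *)
Definition form_act (mu : {scalar glpoly K m}) (t : tensor) : tensor :=
  [ffun I => mu (coact t I)].

Fact form_act_is_linear mu : linear (form_act mu).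
Proof.
move=> a t u; apply/ffunP=> I; rewrite !ffunE.
suff -> : coact (a *: t + u) I = a *: coact t I + coact u I by exact: linearP.
rewrite scaler_sumr -big_split /=; apply: eq_bigr => J _.
by rewrite !ffunE scalerDl scalerA.
Qed.

HB.instance Definition _ mu := GRing.isLinear.Build K tensor tensor *:%R
  (form_act mu) (form_act_is_linear mu).

Definition Psi (mu : distribution K m) : 'End(tensor) := linfun (form_act mu).

Definition schur_algebra : set 'End(tensor) := range Psi.

Definition end_place : set 'End(tensor) :=
  [set phi | forall (s : 'S_r) (t : tensor), phi (place s t) = place s (phi t)]%classic.

Lemma tensor_basis (t : tensor) : t = \sum_(I : multiindex) t I *: tbasis I.
Proof.
apply/ffunP=> I; rewrite sum_ffunE (bigD1 I) //= big1 => [|J neJI].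
  by rewrite !ffunE eqxx addr0 [_ *: _]mulr1.
by rewrite !ffunE eq_sym (negPf neJI) [_ *: _]mulr0.
Qed.

Lemma mi_actM I (s u : 'S_r) : mi_act (mi_act I s) u = mi_act I (s * u)%g.
Proof. by apply/ffunP=> k; rewrite !ffunE invMg permM. Qed.

Lemma mi_act1 I : mi_act I 1%g = I.
Proof. by apply/ffunP=> k; rewrite !ffunE invg1 perm1. Qed.

Lemma mi_act_tperm I (j k l : 'I_r) : mi_act I (tperm j k) l = I (tperm j k l).
Proof. by rewrite ffunE tpermV. Qed.

Lemma placeE s (t : tensor) J : place s t J = t (mi_act J (s^-1)%g).
Proof.
rewrite sum_ffunE (bigD1 (mi_act J (s^-1)%g)) //= big1 => [|I neI].
  by rewrite !ffunE mi_actM mulVg mi_act1 eqxx addr0 [_ *: _]mulr1.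
rewrite !ffunE; case: eqP => [eJ|_]; last exact: mulr0.
by rewrite eJ mi_actM mulgV mi_act1 eqxx in neI.
Qed.

Lemma place_tbasis s I : place s (tbasis I) = tbasis (mi_act I s).
Proof.
apply/ffunP=> J; rewrite placeE !ffunE; congr (_%:R); congr (nat_of_bool _).
apply/eqP/eqP=> [<-|->]; by rewrite mi_actM ?mulVg ?mulgV mi_act1.
Qed.

(** Evaluation at a matrix g acts diagonally. *)
Lemma form_act_point (g : 'M[K]_m) (w : 'I_r -> 'cV[K]_m) :
  form_act (meval (glpoint g)) (pure_tensor w)
    = pure_tensor (fun k => g *m w k).
Proof.
apply/ffunP=> I; rewrite !ffunE /coact raddf_sum /=.
under [RHS]eq_bigr do rewrite mxE.
rewrite bigA_distr_bigA /=; apply: eq_bigr => J _.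
rewrite mevalZ rmorph_prod ffunE mulrC -big_split /=.
apply: eq_bigr => k _; congr (_ * _).
by rewrite /xgen mevalXU /glpoint row_mxEl mxvecE.
Qed.

End TensorSpace.

(* Main.v *)
Require Import Defs.
From HB Require Import structures.
From mathcomp Require Import all_boot all_order all_fingroup all_algebra.
From mathcomp Require Import mpoly.
From mathcomp Require Import classical_sets cardinality.

(** An endomorphism of the tensor power is its matrix a(I, J), the coefficient
    of v_I in the image of v_J, and it commutes with place permutations exactly
    when a(I, J) = a(I.s, J.s) for all s. A linear form mu on K[GL(m)] acts by
    the matrix mu(x_IJ), where x_IJ is the product over k of the x_(i_k j_k).
    As the x_ij commute, x_IJ = x_(I.s)(J.s), so Psi lands in the commuting
    endomorphisms ([form_act_place]).

    Conversely, x_IJ = x_I'J' forces (I', J') = (I.s, J.s) for some s, because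
    equal monomials list the same pairs (i_k, j_k) up to order
    ([eq_mi_monom]). An invariant matrix a is therefore the family of values of
    some linear form lambda at the monomials x_IJ ([scalar_on_monom]). What
    remains is to find a distribution that agrees with lambda on homogeneous
    polynomials of degree r in the x_ij.

    Such a polynomial is its own Taylor polynomial of order r at the identity
    matrix. So mu(f) := lambda(Taylor polynomial of order r of f at 1) agrees
    with lambda there ([jet_line_eval_prod]); it kills the (r+1)-st power of
    the augmentation ideal, as products of r + 1 functions vanishing at 1 have
    zero Taylor polynomial of order r ([jet_form_order]). To compute Taylor
    polynomials, restrict f to the line 1 + t (x - 1) from the identity to the
    generic matrix x, truncate in degree r with respect to t, and set t = 1.
    The coordinate d, the inverse of the determinant, is sent to the geometric
    series for the inverse of the determinant along this line, cut so that the
    relation d det = 1 holds modulo t^(r+1) ([line_eval_glrel]). *)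

(** * Jets of univariate polynomials *)

Section UnivariateJets.
Set Implicit Arguments.
Unset Strict Implicit.
Import GRing.Theory.
Local Open Scope ring_scope.

(** The value at 1 of the truncation of p in degrees at most r. *)
Definition jet (A : comNzRingType) (r : nat) (p : {poly A}) : A :=
  \sum_(i < r.+1) p`_i.

Fact jet_is_linear (A : comNzRingType) r : scalar (@jet A r).
Proof.
move=> c p q; rewrite /jet mulr_sumr -big_split /=.
by apply: eq_bigr => i _; rewrite coefD coefZ.
Qed.

HB.instance Definition _ (A : comNzRingType) r :=
  GRing.isLinear.Build A {poly A} A *%R (jet r) (@jet_is_linear A r).

Lemma jet_small (A : comNzRingType) r (p : {poly A}) :
  (size p <= r.+1)%N -> jet r p = p.[1].
Proof.
move=> /horner_coef_wide ->; apply: eq_bigr => i _.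
by rewrite expr1n mulr1.
Qed.

Lemma jet_mulXn (A : comNzRingType) r (p : {poly A}) :
  jet r (p * 'X^(r.+1)) = 0.
Proof. by rewrite /jet big1 // => i _; rewrite coefMXn ltn_ord. Qed.

Lemma coef0_eq0 (A : nzSemiRingType) (p : {poly A}) :
  p`_0 = 0 -> p = drop_poly 1 p * 'X.
Proof.
move=> p0; rewrite -[LHS](poly_take_drop 1) expr1.
suff -> : take_poly 1 p = 0 by rewrite add0r.
by apply/polyP=> -[|i]; rewrite coef_take_poly coef0.
Qed.

Lemma prod_coef0_eq0 (A : comNzRingType) (ps : seq {poly A}) :
  (forall p, p \in ps -> p`_0 = 0) ->
  exists q, \prod_(p <- ps) p = q * 'X^(size ps).
Proof.
elim: ps => [|p ps IH] ps0; first by exists 1; rewrite big_nil mul1r.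
case: IH => [q' q'ps|q eq_q]; first by apply: ps0; rewrite inE q'ps orbT.
have p0 : p`_0 = 0 by apply: ps0; rewrite mem_head.
exists (drop_poly 1 p * q); rewrite big_cons eq_q {1}(coef0_eq0 p0) exprS.
by rewrite mulrACA.
Qed.

End UnivariateJets.

(** * The Taylor polynomial at the identity matrix *)

Section LineThroughIdentity.
Set Implicit Arguments.
Unset Strict Implicit.
Import GRing.Theory.
Local Open Scope ring_scope.
Variables (K : fieldType) (m r : nat).
Local Notation A := (glpoly K m).

(** The point at time t = 'X of the line from the identity matrix, at t = 0, to
    the generic matrix, at t = 1. *)
Definition line_mx : 'M[{poly A}]_m :=
  \matrix_(i, j) ((i == j)%:R + (xgen K i j - (i == j)%:R)%:P * 'X).

(** The determinant along the line is 1 - z with z divisible by 'X, so its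
    inverse as a power series in 'X is the sum of the powers of z; those beyond
    z ^+ r are invisible modulo 'X^(r.+1). *)
Definition line_inv_det : {poly A} :=
  \sum_(k < r.+1) (1 - \det line_mx) ^+ k.

Definition line_point (k : 'I_(m * m + 1)) : {poly A} :=
  row_mx (mxvec line_mx) (const_mx line_inv_det : 'rV_1) ord0 k.

(** Restriction to the line of a function on GL(m). It respects the relation
    d * det = 1 only modulo 'X^(r.+1), hence is defined on the polynomial ring
    and not on its quotient. *)
Definition line_eval : A -> {poly A} :=
  mmap (polyC \o @mpolyC (m * m + 1) K) line_point.

HB.instance Definition _ := GRing.RMorphism.on line_eval.

Lemma line_evalZ c f : line_eval (c *: f) = (c%:MP)%:P * line_eval f.
Proof. exact: mmapZ. Qed.

Lemma line_eval_xgen i j : line_eval (xgen K i j) = line_mx i j.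
Proof.
by rewrite /line_eval /xgen mmapX mmap1U /line_point row_mxEl mxvecE.
Qed.

Lemma line_eval_dgen : line_eval (dgen K m) = line_inv_det.
Proof. by rewrite /line_eval /dgen mmapX mmap1U /line_point row_mxEr mxE. Qed.

Lemma line_mx_coef0 : map_mx (horner_eval 0) line_mx = 1%:M.
Proof.
apply/matrixP=> i j; rewrite !mxE /horner_eval.
by rewrite !hornerE -polyC_natr hornerC.
Qed.

Lemma det_line_mx_coef0 : (\det line_mx)`_0 = 1.
Proof.
rewrite -horner_coef0 -[LHS]/(horner_eval 0 _) -det_map_mx.
by rewrite line_mx_coef0 det1.
Qed.

Lemma line_inv_det_coef0 : line_inv_det`_0 = 1.
Proof.
rewrite -horner_coef0 -[LHS]/(horner_eval 0 _) rmorph_sum big_ord_recl /=.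
rewrite expr0 rmorph1 big1 ?addr0 // => i _.
rewrite rmorphXn rmorphB rmorph1 /= /horner_eval horner_coef0.
by rewrite det_line_mx_coef0 subrr exprS mul0r.
Qed.

(** With z := 1 - \det line_mx, divisible by 'X, the geometric sum gives
    line_inv_det * (1 - z) = 1 - z ^+ r.+1. *)
Lemma line_eval_glrel : line_eval (glrel K m) =
  - (drop_poly 1 (1 - \det line_mx) ^+ r.+1) * 'X^(r.+1).
Proof.
rewrite /glrel rmorphB rmorphM rmorph1 /= line_eval_dgen -det_map_mx /=.
have -> : map_mx line_eval (xmx K m) = line_mx.
  by apply/matrixP=> i j; rewrite mxE [xmx _ _ _ _]mxE line_eval_xgen.
rewrite mulNr -exprMn -coef0_eq0; last first.
  by rewrite coefB coef1 det_line_mx_coef0 subrr.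
have -> : line_inv_det * \det line_mx = 1 - (1 - \det line_mx) ^+ r.+1.
  by rewrite -[RHS]opprB subrX1 -mulNr opprB subKr mulrC.
by rewrite addrAC subrr add0r.
Qed.

(** At time 0 the line passes through the identity, and the image of the
    coordinate d has constant term 1. *)
Lemma line_eval_coef0 f : (line_eval f)`_0 = (counit f)%:MP.
Proof.
rewrite -horner_coef0 -[LHS]/(horner_eval 0 _) /line_eval /counit /mmap /meval.
rewrite /mmap !rmorph_sum /=; apply: eq_bigr => M _.
rewrite !rmorphM /= {1}/horner_eval hornerC; congr (_ * _).
rewrite /mmap1 !rmorph_prod /=; apply: eq_bigr => k _; rewrite !rmorphXn /=.
congr (_ ^+ _); rewrite /line_point /glpoint.
case: (splitP k) => j ek.
  have -> : k = lshift 1 j by exact: val_inj.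
  rewrite !row_mxEl; case/mxvec_indexP: j {ek} => i j.
  rewrite !mxvecE; move/matrixP: line_mx_coef0 => /(_ i j).
  by rewrite !mxE mpolyC_nat.
have -> : k = rshift (m * m) j by exact: val_inj.
rewrite !row_mxEr !mxE det1 invr1 /horner_eval horner_coef0.
exact: line_inv_det_coef0.
Qed.

(** Each factor is affine in t, so the restriction to the line has degree at
    most r and truncation does not change it; at t = 1 the line is at the
    generic matrix. *)
Lemma jet_line_eval_prod (I J : {ffun 'I_r -> 'I_m}) :
  jet r (line_eval (\prod_(k < r) xgen K (I k) (J k)))
    = \prod_(k < r) xgen K (I k) (J k).
Proof.
have sz i j : (size (line_mx i j) <= 2)%N.
  rewrite mxE (leq_trans (size_polyD _ _)) // geq_max -polyC_natr.
  rewrite (leq_trans (size_polyC_leq1 _)) //=.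
  rewrite (leq_trans (size_polyMleq _ _)) // size_polyX addn2 /= ltnS.
  exact: size_polyC_leq1.
rewrite rmorph_prod jet_small /=.
  rewrite horner_prod; apply: eq_bigr => k _; rewrite line_eval_xgen mxE.
  by rewrite hornerD hornerMX mulr1 -polyC_natr !hornerC subrKC.
apply: leq_trans (size_poly_prod_leq _ _) _.
rewrite leq_subLR card_ord (addnS r) ltnS.
apply: (@leq_trans (\sum_(k < r) 2)%N).
  by apply: leq_sum => k _; rewrite line_eval_xgen.
by rewrite sum_nat_const card_ord muln2 addnn.
Qed.

Section JetDistribution.
Variable lambda : {scalar A}.

(** The form lambda applied to the Taylor polynomial of order r of f at the
    identity matrix. *)
Definition jet_form (f : A) : K := lambda (jet r (line_eval f)).

Fact jet_form_is_linear : scalar jet_form.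
Proof.
move=> c f g; rewrite /jet_form rmorphD /= line_evalZ mul_polyC.
by rewrite linearP /= mul_mpolyC linearP.
Qed.

HB.instance Definition _ :=
  GRing.isLinear.Build K A K *%R jet_form jet_form_is_linear.

Fact jet_form_rel f : jet_form (f * glrel K m) = 0.
Proof.
by rewrite /jet_form rmorphM /= line_eval_glrel mulrA jet_mulXn raddf0.
Qed.

(** The order is n = r: functions vanishing at the identity restrict to
    multiples of 'X on the line. *)
Fact jet_form_order : exists n : nat, forall fs : seq A,
  size fs = n.+1 -> {in fs, forall f, counit f = 0} ->
  jet_form (\prod_(f <- fs) f) = 0.
Proof.
exists r => fs sz_fs fs0; rewrite /jet_form rmorph_prod /=.
case: (@prod_coef0_eq0 A (map line_eval fs)) => [p /mapP[f /fs0 f0 ->]|q].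
  by rewrite line_eval_coef0 f0 mpolyC0.
rewrite big_map size_map sz_fs => ->.
by rewrite jet_mulXn raddf0.
Qed.

Definition jet_distribution : distribution K m :=
  Distribution jet_form_rel jet_form_order.

End JetDistribution.

End LineThroughIdentity.

(** * Pairs of multi-indices and monomials *)

Section Coefficients.
Set Implicit Arguments.
Unset Strict Implicit.
Import GRing.Theory.
Local Open Scope ring_scope.
Variables (K : fieldType) (m r : nat).
Local Notation A := (glpoly K m).
Local Notation multiindex := {ffun 'I_r -> 'I_m}.

Definition mi_monom (I J : multiindex) : 'X_{1.. m * m + 1} :=
  (\sum_(k < r) U_(lshift 1 (mxvec_index (I k) (J k))))%MM.

Lemma prod_xgen (I J : multiindex) :
  \prod_(k < r) xgen K (I k) (J k) = 'X_[mi_monom I J].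
Proof. by rewrite /mi_monom -mprodXE. Qed.

Lemma mi_monom_count I J i j :
  mi_monom I J (lshift 1 (mxvec_index i j))
    = count_mem (i, j) [tuple (I k, J k) | k < r].
Proof.
rewrite /mi_monom mnm_sumE count_map -sum1_count big_enum_cond.
rewrite [RHS]big_mkcond /=.
apply: eq_bigr => k _; rewrite mnm1E (inj_eq (@lshift_inj _ _)).
by rewrite (inj_eq (@cast_ord_inj _ _ _)) (inj_eq enum_rank_inj); case: eqP.
Qed.

(** The exponents count how often each pair (i, j) occurs among the
    (i_k, j_k), so equal monomials come from sequences of pairs that are
    permutations of each other. *)
Lemma eq_mi_monom I J I' J' : mi_monom I J = mi_monom I' J' ->
  exists s : 'S_r, I' = mi_act I s /\ J' = mi_act J s.
Proof.
move=> eqM.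
have /tuple_permP[s eq_s] : perm_eq [tuple (I' k, J' k) | k < r]
                                    [tuple (I k, J k) | k < r].
  by apply/allP=> -[i j] _ /=; rewrite -!mi_monom_count eqM.
exists (s^-1)%g; move/val_inj: eq_s => eq_s.
have E k : (I' k, J' k) = (I (s k), J (s k)).
  by have := congr1 (fun t => tnth t k) eq_s; rewrite !tnth_mktuple.
by split; apply/ffunP=> k; rewrite ffunE invgK; case: (E k).
Qed.

Lemma mi_act_prod_xgen (I J : multiindex) (s : 'S_r) :
  \prod_(k < r) xgen K (mi_act I s k) (mi_act J s k)
    = \prod_(k < r) xgen K (I k) (J k).
Proof.
rewrite (reindex_inj (@perm_inj _ s)) /=; apply: eq_bigr => k _.
by rewrite !ffunE permK.
Qed.

(** Distinct monomials are linearly independent, so a linear form may be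
    prescribed freely on them; invariance under simultaneous permutation is what
    makes the prescription depend on the monomial only. *)
Lemma scalar_on_monom (a : multiindex -> multiindex -> K) :
  (forall I J s, a (mi_act I s) (mi_act J s) = a I J) ->
  exists lambda : {scalar A},
    forall I J : multiindex, lambda (\prod_(k < r) xgen K (I k) (J k)) = a I J.
Proof.
move=> a_inv.
(* c N reads a at any pair (I, J) with monomial N, and Ms removes repetitions
   so that each monomial is counted once, whatever the characteristic. *)
pose c N := if [pick P | mi_monom P.1 P.2 == N] is Some P then a P.1 P.2 else 0.
pose Ms := undup [seq mi_monom P.1 P.2 | P : multiindex * multiindex].
pose lam (f : A) : K := \sum_(N <- Ms) f@_N * c N.
have lam_lin : scalar lam.
  move=> x f g; rewrite /lam mulr_sumr -big_split /=.
  by apply: eq_bigr => N _; rewrite mcoeffD mcoeffZ mulrDl mulrA.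
pose L : {scalar A} := HB.pack lam (GRing.isLinear.Build K A K *%R lam lam_lin).
exists L => I J; rewrite -[LHS]/(lam _).
rewrite /lam prod_xgen (bigD1_seq (mi_monom I J)) ?undup_uniq //=; last first.
  by rewrite mem_undup; apply/mapP; exists (I, J); rewrite ?mem_enum.
rewrite mcoeffX eqxx mul1r big1 ?addr0 => [|N neN]; last first.
  by rewrite mcoeffX eq_sym (negPf neN) mul0r.
rewrite /c; case: pickP => [[I' J'] /eqP /=|/(_ (I, J))]; last by rewrite eqxx.
by move=> /eq_mi_monom[s [-> ->]]; rewrite a_inv.
Qed.

End Coefficients.

(** * Double centralizer property *)

Section SchurAlgebra.
Set Implicit Arguments.
Unset Strict Implicit.
Import GRing.Theory.
Local Open Scope ring_scope.
Variables (K : fieldType) (m r : nat).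
Local Notation A := (glpoly K m).
Local Notation multiindex := {ffun 'I_r -> 'I_m}.
Local Notation tensor := {ffun multiindex -> K^o}.

Lemma coact_tbasis (I J : multiindex) :
  coact (tbasis K J) I = \prod_(k < r) xgen K (I k) (J k).
Proof.
rewrite /coact (bigD1 J) //= [X in _ + X]big1 => [|J' neJ]; last first.
  by rewrite /tbasis ffunE (negPf neJ) scale0r.
by rewrite /tbasis ffunE eqxx scale1r addr0.
Qed.

Lemma lfun_eq_coef (phi psi : 'End(tensor)) :
  (forall I J, phi (tbasis K J) I = psi (tbasis K J) I) -> phi = psi.
Proof.
move=> e; apply/lfunP=> t; rewrite (tensor_basis t) !linear_sum.
apply: eq_bigr => J _; rewrite !linearZ; congr (_ *: _).
by apply/ffunP=> I; apply: e.
Qed.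

Lemma mi_act_inj (s : 'S_r) : injective (fun I : multiindex => mi_act I s).
Proof.
apply: (can_inj (g := (@mi_act m r)^~ (s^-1)%g)) => I.
by rewrite mi_actM mulgV mi_act1.
Qed.

Lemma form_act_place (mu : {scalar A}) (s : 'S_r) (t : tensor) :
  form_act mu (place s t) = place s (form_act mu t).
Proof.
apply/ffunP=> I; rewrite placeE !ffunE; congr (mu _).
rewrite /coact (reindex_inj (@mi_act_inj s)) /=.
apply: eq_bigr => J _; rewrite placeE mi_actM mulgV mi_act1; congr (_ *: _).
by rewrite -[RHS](mi_act_prod_xgen K _ _ s) mi_actM mulVg mi_act1.
Qed.

Lemma commuting_coef_inv (phi : 'End(tensor)) :
  end_place phi -> forall I J s,
  phi (tbasis K (mi_act J s)) (mi_act I s) = phi (tbasis K J) I.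
Proof.
move=> phiC I J s.
by rewrite -place_tbasis phiC placeE mi_actM mulgV mi_act1.
Qed.

End SchurAlgebra.

Theorem proposition2p3 (K : fieldType) (m r : nat)
  (Kinf : infinite_set [set: K]%classic) (m_gt0 : 0 < m) (r_gt0 : 0 < r) :
  @schur_algebra K m r = @end_place K m r.
Proof.
apply/seteqP; split=> [_ [mu _ <-] s t|phi phiC].
  by rewrite !lfunE /= form_act_place.
have [lambda lambdaE] := @scalar_on_monom K m r
  (fun I J => phi (tbasis K J) I) (commuting_coef_inv phiC).
exists (jet_distribution r lambda) => //; apply: lfun_eq_coef => I J.
by rewrite lfunE /= ffunE coact_tbasis /= /jet_form jet_line_eval_prod lambdaE.
Qed.
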